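(* Let $2 \le q \le r$ be integers and $0 \le a \le 1$. Let $f : \binom{[q]}{2} \to [0,1]$ be defined by $f(12) = a$ and $f(ij) = 0$ for all $\{i,j\} \ne \{1,2\}$, and let $\mathcal{F} = \{(q,f), K_{r+1}^0\}$. Then $$d(\mathcal{F}) = \max\left\{1 - \frac{1}{q-1},\ a\left(1 - \frac1r\right)\right\}.$$
   Context: An edge weighting of a graph $G$ is a map $w : E(G) \to [0,1]$; for an $n$-vertex graph, $w(G) := \frac{2}{n^2}\sum_{e\in E(G)} w(e)$. A weighted clique is a pair $(r,f)$ with $f : \binom{[r]}{2} \to [0,1]$; $(G,w)$ contains $(r,f)$ if there is an injective $\phi:[r]\to V(G)$ with $\phi(i)\phi(j) \in E(G)$ and $w(\phi(i)\phi(j)) > f(ij)$ for all $i<j$. For $a \in [0,1]$, $K_r^a$ is the weighted clique $(r,f)$ with $f \equiv a$. For a set $\mathcal{F}$ of weighted cliques, $(G,w)$ is $\mathcal{F}$-free if it contains none of them; $\beta_n(\mathcal{F})$ is the maximum of $w(G)$ over $\mathcal{F}$-free weighted graphs on $n$ vertices, and $d(\mathcal{F}) := \lim_{n\to\infty}\beta_n(\mathcal{F})$. *)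

(* Defs.v *)
From HB Require Import structures.
From mathcomp Require Import all_boot all_order all_algebra.
From mathcomp Require Import all_classical all_reals all_analysis.

Set Implicit Arguments.
Unset Strict Implicit.
Unset Printing Implicit Defensive.

Import Order.TTheory GRing.Theory Num.Theory.
Import numFieldNormedType.Exports.

Local Open Scope classical_set_scope.
Local Open Scope ring_scope.

(* A finite simple graph on T, given by its set of edges (two-element subsets
   of T), with a weight in [0,1] on each edge.  The values of weight outside
   edges play no role. *)
Record wgraph (R : realType) (T : finType) := WGraph {
  edges : {set {set T}};
  weight : {set T} -> R;
  card_edge : forall e, e \in edges -> #|e| = 2%N;
  weight01 : forall e, e \in edges -> 0 <= weight e <= 1 }.

Definition density (R : realType) (T : finType) (G : wgraph R T) : R :=
  2 / #|T|%:R ^+ 2 * \sum_(e in edges G) weight G e.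

(* The pair (r, f); the index set {1, ..., r} is 'I_r, i.e. {0, ..., r - 1}, and
   only the values of f on two-element subsets play a role. *)
Record wclique (R : realType) := WClique {
  csize : nat;
  cweight : {set 'I_csize} -> R;
  cweight01 : forall e : {set 'I_csize}, #|e| = 2%N -> 0 <= cweight e <= 1 }.

Arguments cweight {R} w _.

Definition contains (R : realType) (T : finType) (G : wgraph R T)
    (C : wclique R) : Prop :=
  exists phi : 'I_(csize C) -> T, injective phi /\
    forall i j : 'I_(csize C), (i < j)%N ->
      [set phi i; phi j]%SET \in edges G /\
      cweight C [set i; j]%SET < weight G [set phi i; phi j]%SET.

Definition is_free (R : realType) (T : finType) (F : set (wclique R))
    (G : wgraph R T) : Prop :=
  forall C, F C -> ~ contains G C.

(* The supremum is a maximum: see beta_attained and beta_ub below. *)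
Definition beta (R : realType) (F : set (wclique R)) (n : nat) : R :=
  sup [set density G | G in [set G : wgraph R 'I_n | is_free F G]].

(* d(F); "lim" is total, so this is only meaningful when the limit exists. *)
Definition turan_density (R : realType) (F : set (wclique R)) : R :=
  lim (beta F n @[n --> \oo]).

Fact const_weight01 (R : realType) (r : nat) (a : R) (ha : 0 <= a <= 1)
  (e : {set 'I_r}) : #|e| = 2%N -> 0 <= a <= 1.
Proof. by []. Qed.

(* K_r^a *)
Definition Kclique (R : realType) (r : nat) (a : R) (ha : 0 <= a <= 1) :
    wclique R :=
  @WClique R r (fun=> a) (const_weight01 ha).

(* For 2 <= q, the set [set i : 'I_q | (i < 2)%N] is the pair {1, 2} of
   {1, ..., q} (here {0, 1}). *)
Definition pair_weight (R : realType) (q : nat) (a : R) (e : {set 'I_q}) : R :=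
  if e == [set i : 'I_q | (i < 2)%N]%SET then a else 0.

Fact pair_weight01 (R : realType) (q : nat) (a : R) (ha : 0 <= a <= 1)
  (e : {set 'I_q}) : #|e| = 2%N -> 0 <= pair_weight a e <= 1.
Proof. by move=> _; rewrite /pair_weight; case: ifP; rewrite // lexx ler01. Qed.

Definition pair_clique (R : realType) (q : nat) (a : R) (ha : 0 <= a <= 1) :
    wclique R :=
  @WClique R q (@pair_weight R q a) (pair_weight01 ha).

Fact zero01 (R : realType) : 0 <= (0 : R) <= 1.
Proof. by rewrite lexx ler01. Qed.

Lemma density_le (R : realType) (T : finType) (G : wgraph R T) :
  density G <= 2 / #|T|%:R ^+ 2 * #|edges G|%:R.
Proof.
rewrite ler_wpM2l ?divr_ge0 ?exprn_ge0 ?ler0n// -sum1_card natr_sum.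
by apply: ler_sum => e /(weight01 (w:=G))/andP[].
Qed.

Lemma beta_ub (R : realType) (F : set (wclique R)) (n : nat)
  (G : wgraph R 'I_n) : is_free F G -> density G <= beta F n.
Proof.
move=> freeG; apply: ub_le_sup; last by exists G.
exists (2 / #|'I_n|%:R ^+ 2 * #|{set 'I_n}|%:R) => _ [H _ <-].
apply: (le_trans (density_le H)).
rewrite ler_wpM2l ?divr_ge0 ?exprn_ge0 ?ler0n// ler_nat.
exact: max_card.
Qed.

Section attained.
Import ArrowAsProduct.
Variables (R : realType) (F : set (wclique R)) (T : finType).

Let edges_free (E : {set {set T}}) (w : {set T} -> R) :=
  forall C, F C -> ~ exists phi : 'I_(csize C) -> T, injective phi /\
    forall i j : 'I_(csize C), (i < j)%N ->
      [set phi i; phi j]%SET \in E /\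
      cweight C [set i; j]%SET < w [set phi i; phi j]%SET.

Let adm (E : {set {set T}}) : set ({set T} -> R) :=
  [set w | (forall e, `[0, 1]%classic (w e)) /\ edges_free E w].

Let tot (E : {set {set T}}) (w : {set T} -> R) : R := \sum_(e in E) w e.

Let eval_continuous (e : {set T}) : continuous (fun w : {set T} -> R => w e).
Proof. exact: (@proj_continuous _ (fun=> R : topologicalType) e). Qed.

Let adm_compact E : compact (adm E).
Proof.
have cbox : compact [set w : {set T} -> R | forall e, `[0, 1]%classic (w e)].
  apply: (@tychonoff _ (fun=> R : topologicalType) (fun=> `[0, 1]%classic)).
  by move=> _; exact: segment_compact.
suff cl : closed [set w : {set T} -> R | edges_free E w].
  exact: (compact_closedI cbox cl).
have -> : [set w : {set T} -> R | edges_free E w] =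
  \bigcap_(C in F) \bigcap_(phi in [set phi : 'I_(csize C) -> T | injective phi])
  \bigcup_(p in [set p : 'I_(csize C) * 'I_(csize C) | (p.1 < p.2)%N])
   [set w | [set phi p.1; phi p.2]%SET \in E ->
      w [set phi p.1; phi p.2]%SET <= cweight C [set p.1; p.2]%SET].
  apply/seteqP; split => [w H C FC phi inj|w H C FC [phi [inj hphi]]].
    apply: contrapT => nex; apply: (H C FC); exists phi; split => // i j ij.
    split; apply: contrapT => h; apply: nex; exists (i, j) => //=.
    by move=> _; rewrite leNgt; apply/negP.
  have [[i j]/= ij] := H C FC phi inj.
  by have [h1 h2] := hphi i j ij => /(_ h1); rewrite leNgt h2.
apply: closed_bigI => C _; apply: closed_bigI => phi _.
apply: closed_bigcup => [|[i j] _ /=]; first exact: finite_finset.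
have [inE|ninE] := boolP ([set phi i; phi j]%SET \in E); last first.
  rewrite [X in closed X](_ : _ = setT); first exact: closedT.
  by apply/seteqP; split.
rewrite [X in closed X](_ : _ = (fun w : {set T} -> R => w [set phi i; phi j]%SET)
   @^-1` [set x | x <= cweight C [set i; j]%SET]).
  apply: preimage_closed; last exact: closed_le.
  by move=> w _; exact: eval_continuous.
by apply/seteqP; split => w /=; [exact|].
Qed.

Let tot_continuous E : continuous (tot E).
Proof.
apply: continuous_big => [x|e _]; last exact: eval_continuous.
exact: add_continuous.
Qed.

Let trunc (G : wgraph R T) e := if e \in edges G then weight G e else 0.

Let adm_trunc (G : wgraph R T) : is_free F G -> adm (edges G) (trunc G).
Proof.
move=> fG; split => [e|C FC [phi [inj hphi]]].
  rewrite /trunc /= in_itv/=; case: ifPn => [/weight01//|_].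
  by rewrite lexx ler01.
apply: (fG C FC); exists phi; split => // i j /hphi[h1 h2]; split => //.
by rewrite /trunc h1 in h2.
Qed.

Let tot_trunc (G : wgraph R T) :
  tot (edges G) (trunc G) = \sum_(e in edges G) weight G e.
Proof. by apply: eq_bigr => e eG; rewrite /trunc eG. Qed.

Lemma free_attained : (exists G : wgraph R T, is_free F G) ->
  exists G : wgraph R T, is_free F G /\
    forall H : wgraph R T, is_free F H -> density H <= density G.
Proof.
move=> [G0 fG0].
pose P (E : {set {set T}}) := `[< adm E !=set0 /\ forall e, e \in E -> #|e| = 2%N >].
have Pfree G : is_free F G -> P (edges G).
  move=> fG; apply/asboolP; split; last exact: card_edge.
  by exists (trunc G); exact: adm_trunc.
have hw E : exists w, P E -> adm E w /\ forall v, adm E v -> tot E v <= tot E w.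
  have [/asboolP[ne _]|nP] := boolP (P E); last by exists (fun=> 0).
  have [w /set_mem wE hw] := compact_EVT_max ne (@adm_compact E)
    (continuous_subspaceT (@tot_continuous E)).
  by exists w => _; split => // v /mem_set; exact: hw.
have [w {}hw] := choice hw.
case: (arg_maxP (fun E => tot E (w E)) (Pfree _ fG0)) => E PE Emax.
have [[box fr] wmax] := hw E PE.
have [_ card2] := asboolP _ PE.
have w01 e : e \in E -> 0 <= w E e <= 1 by move=> _; have := box e; rewrite /= in_itv.
exists (WGraph card2 w01); split => [//|H fH].
rewrite /density ler_wpM2l ?divr_ge0 ?exprn_ge0 ?ler0n//= -tot_trunc.
apply: le_trans (Emax _ (Pfree _ fH)).
by have [_] := hw _ (Pfree _ fH); apply; exact: adm_trunc.
Qed.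

End attained.

Lemma beta_attained (R : realType) (F : set (wclique R)) (n : nat) :
  (exists G : wgraph R 'I_n, is_free F G) ->
  exists G : wgraph R 'I_n, is_free F G /\ density G = beta F n.
Proof.
move=> /free_attained[G [fG Gmax]]; exists G; split => //.
apply/eqP; rewrite eq_le beta_ub//=; apply: ge_sup; first by exists (density G), G.
by move=> _ [H fH <-]; exact: Gmax.
Qed.

(* Main.v *)
Require Import Defs.
From mathcomp Require Import all_boot all_order all_algebra.
From mathcomp Require Import all_classical all_reals all_analysis.
From mathcomp Require Import ring lra.

Set Implicit Arguments.
Unset Strict Implicit.
Unset Printing Implicit Defensive.

Import Order.TTheory GRing.Theory Num.Theory.
Import numFieldNormedType.Exports.

Local Open Scope classical_set_scope.
Local Open Scope ring_scope.

(* Upper bound, valid for every n >= 1: the density is the value at the uniform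
   distribution of the quadratic form of the weights, and by the Motzkin-Straus
   argument this form on the simplex is at most its value at some distribution
   supported on a clique S of positive-weight edges. Such an S has at most r
   vertices; if it has at least q of them, all its weights are at most a, giving
   a (1 - 1/r), and otherwise its size is at most q - 1, giving 1 - 1/(q - 1).
   Lower bound: the balanced complete multipartite graphs with q - 1 parts and
   weight 1, or r parts and weight a, are free and reach these values up to
   1/n. *)

(** * Quadratic forms on the simplex *)

Definition qform (R : realType) (T : finType) (W : T -> T -> R) (x : T -> R) : R :=
  \sum_u \sum_v W u v * x u * x v.

Lemma sum_delta (R : realType) (T : finType) (F : T -> R) (u : T) :
  \sum_v F v * (v == u)%:R = F u.
Proof.
rewrite (bigD1 u)//= eqxx mulr1 big1 ?addr0// => v /negPf ->.
by rewrite mulr0.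
Qed.

(** The coefficient of [t ^+ 2] is [W u u - 2 * W u v + W v v], which vanishes; symmetry merges the
    two cross terms into the factor 2. *)
Lemma qform_shift (R : realType) (T : finType) (W : T -> T -> R) (x : T -> R)
    (u v : T) (t : R) :
  (forall y z, W y z = W z y) -> (forall y, W y y = 0) -> W u v = 0 ->
  qform W (fun y => x y + t * ((y == u)%:R - (y == v)%:R)) =
  qform W x + 2 * t * (\sum_z W u z * x z - \sum_z W v z * x z).
Proof.
move=> Wsym Wdiag Wuv; set d := fun y => (y == u)%:R - (y == v)%:R : R.
have sumd F : \sum_y F y * d y = F u - F v.
  under eq_bigr do rewrite mulrBr.
  by rewrite sumrB !sum_delta.
pose L y := \sum_z W y z * x z.
(* Summing over the inner index first: there [x] gives [L y] and [d] gives [W y u - W y v]. *)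
have -> : qform W (fun y => x y + t * d y) = \sum_y ((x y + t * d y) * L y
    + (t * x y * (W y u - W y v) + t ^+ 2 * (W y u - W y v) * d y)).
  apply: eq_bigr => y _; rewrite -sumd /L !mulr_sumr mulr_suml -!big_split/=.
  by apply: eq_bigr => z _; ring.
have -> : qform W x = \sum_y x y * L y.
  by apply: eq_bigr => y _; rewrite /L mulr_sumr; apply: eq_bigr => z _; ring.
have Lsym w : \sum_y x y * W y w = L w.
  by apply: eq_bigr => y _; rewrite mulrC Wsym.
rewrite !big_split/= (sumd (fun y => t ^+ 2 * (W y u - W y v))).
under eq_bigr do rewrite mulrDl.
rewrite big_split/=.
under [X in _ + X + _]eq_bigr do rewrite -mulrA (mulrC (d _)) mulrA.
rewrite (sumd (fun y => t * L y)).
under [X in _ + (X + _)]eq_bigr do rewrite -mulrA mulrBr mulrBr.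
rewrite sumrB -!mulr_sumr !Lsym !Wdiag (Wsym v u) Wuv -/(L u) -/(L v).
ring.
Qed.

(** With a zero diagonal the form is at most [c] times the off-diagonal mass, that is
    [c * (1 - \sum_y x y ^+ 2)], and a distribution on [S] has sum of squares at least
    [1 / #|S|]. *)
Lemma qform_clique_le (R : realType) (T : finType) (W : T -> T -> R)
    (x : T -> R) (S : {set T}) (c : R) :
  (forall y, 0 <= x y) -> \sum_y x y = 1 -> (forall y, y \notin S -> x y = 0) ->
  (forall y, W y y = 0) -> 0 <= c ->
  {in S &, forall u v, W u v <= c} ->
  qform W x <= c * (1 - 1 / #|S|%:R).
Proof.
move=> x0 x1 xS Wdiag c0 Wc.
have sumS (F : T -> R) : (forall y, y \notin S -> F y = 0) ->
    \sum_y F y = \sum_(y in S) F y.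
  by move=> F0; rewrite (bigID (mem S))/= [X in _ + X]big1 ?addr0.
have S0 : (0 < #|S|)%N.
  rewrite card_gt0; apply/eqP => S0.
  have := x1; rewrite big1 => [/eqP|y _]; first by rewrite eq_sym oner_eq0.
  by apply: xS; rewrite S0 inE.
have S0R : (0 : R) < #|S|%:R by rewrite ltr0n.
have le1 : qform W x <= c * (1 - \sum_y x y ^+ 2).
  (* As [x] sums to 1, the bound is itself a double sum with the diagonal removed, so the comparison
     is termwise. *)
  have -> : c * (1 - \sum_y x y ^+ 2) =
     \sum_y \sum_z (c * x y * x z - c * x y * x z * (z == y)%:R).
    under [RHS]eq_bigr => y _.
      rewrite sumrB sum_delta -mulr_sumr x1 mulr1 -mulrA -mulrBr -expr2; over.
    by rewrite -mulr_sumr sumrB x1.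
  apply: ler_sum => y _; apply: ler_sum => z _.
  have [->|zy] := eqVneq z y; first by rewrite Wdiag !mul0r mulr1 subrr.
  rewrite mulr0 subr0.
  have [yS|/xS->] := boolP (y \in S); last by rewrite !mulr0 !mul0r.
  have [zS|/xS->] := boolP (z \in S); last by rewrite !mulr0.
  by rewrite ler_wpM2r// ler_wpM2r// Wc.
apply: (le_trans le1); rewrite ler_wpM2l// lerD2l lerN2.
(* Cauchy-Schwarz, as non-negativity of the variance of x on S. *)
have : 0 <= \sum_(y in S) (x y - 1 / #|S|%:R) ^+ 2.
  by apply: sumr_ge0 => y _; exact: sqr_ge0.
under eq_bigr do rewrite sqrrB.
rewrite big_split/= sumrB -sumS; last by move=> y /xS ->; rewrite expr0n.
rewrite sumr_const sumrMnl -mulr_suml -sumS// x1 mul1r -[X in _ + X]mulr_natl.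
have -> : #|S|%:R * (1 / #|S|%:R) ^+ 2 = 1 / #|S|%:R :> R by field; rewrite gt_eqF.
lra.
Qed.

(* If W u v = 0 the form is affine along the direction e_u - e_v, so all the
   mass of one endpoint can be moved to the other without decreasing it; hence
   the support may be assumed to be a clique. *)
Lemma motzkin_straus (R : realType) (T : finType) (W : T -> T -> R) (M : R) :
  (forall y z, W y z = W z y) -> (forall y, W y y = 0) ->
  (forall S : {set T},
    {in S &, forall u v, u != v -> W u v != 0} -> S != finset.set0 ->
    exists2 c, 0 <= c &
      {in S &, forall u v, W u v <= c} /\ c * (1 - 1 / #|S|%:R) <= M) ->
  forall x : T -> R, (forall y, 0 <= x y) -> \sum_y x y = 1 -> qform W x <= M.
Proof.
move=> Wsym Wdiag cliqueM x.
(* Strong induction on the size of the support. *)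
have [n] := ubnP #|[set y | x y != 0]%SET|.
elim: n x => // n IH x; rewrite ltnS => suppx x0 x1.
set S := [set y | x y != 0]%SET in suppx.
have xS y : y \notin S -> x y = 0 by rewrite inE negbK => /eqP.
have [[u [v [uS vS uv Wuv]]]|noedge] :=
    pselect (exists u v, [/\ u \in S, v \in S, u != v & W u v = 0]).
  pose L y := \sum_z W y z * x z.
  (* [L] is half the gradient of the form, so mass should move towards the endpoint with the larger
     [L]. *)
  wlog Luv : u v uS vS uv Wuv / L v <= L u.
    move=> H; have [/H|/ltW/H] := leP (L v) (L u); first exact.
    by apply => //; [rewrite eq_sym | rewrite Wsym].
  (* The shift [x v] empties [v] exactly and keeps all coordinates non-negative; [u] is already in
     the support, so the support shrinks. *)
  pose x' y := x y + x v * ((y == u)%:R - (y == v)%:R).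
  have x'0 y : 0 <= x' y.
    rewrite /x'; have [->|yv] := eqVneq y v.
      by rewrite eq_sym (negPf uv) sub0r mulrN1 subrr.
    by rewrite subr0 addr_ge0// mulr_ge0.
  apply: (@le_trans _ _ (qform W x')).
    rewrite qform_shift// lerDl mulr_ge0 ?subr_ge0//.
    by rewrite mulr_ge0.
  apply: IH => //.
    apply: leq_trans suppx; apply: proper_card; apply/properP; split.
      apply/fintype.subsetP => y; rewrite !inE; apply: contra => /eqP xy0.
      rewrite /x' xy0; have [yu|] := eqVneq y u.
        by move: uS; rewrite inE -yu xy0 eqxx.
      have [yv|] := eqVneq y v; first by move: vS; rewrite inE -yv xy0 eqxx.
      by rewrite subrr mulr0 addr0.
    exists v => //; rewrite inE negbK /x' eqxx (eq_sym v) (negPf uv) sub0r mulrN1.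
    by rewrite subrr.
  rewrite /x' big_split/= x1 -mulr_sumr sumrB.
  rewrite -[X in X - _](eq_bigr _ (fun y _ => mul1r _)) (sum_delta (fun=> 1)).
  rewrite -[X in _ - X](eq_bigr _ (fun y _ => mul1r _)) (sum_delta (fun=> 1)).
  by rewrite subrr mulr0 addr0.
have [||c c0 [Wc cM]] := cliqueM S.
- by move=> u v uS vS uv; apply/eqP => Wuv; apply: noedge; exists u, v.
- apply/eqP => S0; have := x1; rewrite big1 => [/eqP|y _].
    by rewrite eq_sym oner_eq0.
  by apply: xS; rewrite S0 inE.
by apply: le_trans cM; apply: qform_clique_le.
Qed.

(** * Weighted adjacency matrix and density *)

(** Extending by 0 identifies non-edges with edges of weight 0. Containment is not affected, since
    it asks for a weight strictly above a non-negative bound ([adj_gtP]). *)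
Definition adj (R : realType) (T : finType) (G : wgraph R T) (u v : T) : R :=
  if [set u; v]%SET \in edges G then weight G [set u; v]%SET else 0.

Lemma adjC (R : realType) (T : finType) (G : wgraph R T) (u v : T) :
  adj G u v = adj G v u.
Proof. by rewrite /adj finset.setUC. Qed.

Lemma adjxx (R : realType) (T : finType) (G : wgraph R T) (u : T) : adj G u u = 0.
Proof.
rewrite /adj; case: ifPn => // /(card_edge (w := G)).
by rewrite finset.setUid cards1.
Qed.

Lemma adj_ge0 (R : realType) (T : finType) (G : wgraph R T) (u v : T) :
  0 <= adj G u v.
Proof. by rewrite /adj; case: ifPn => // /(weight01 (w := G))/andP[]. Qed.

Lemma adj_le1 (R : realType) (T : finType) (G : wgraph R T) (u v : T) :
  adj G u v <= 1.
Proof. by rewrite /adj; case: ifPn => // /(weight01 (w := G))/andP[]. Qed.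

Lemma adj_gtP (R : realType) (T : finType) (G : wgraph R T) (u v : T) (c : R) :
  0 <= c -> c < adj G u v ->
  [set u; v]%SET \in edges G /\ c < weight G [set u; v]%SET.
Proof. by move=> c0; rewrite /adj; case: ifPn => // _; rewrite ltNge c0. Qed.

Lemma sum_adj (R : realType) (T : finType) (G : wgraph R T) :
  \sum_u \sum_v adj G u v = 2 * \sum_(e in edges G) weight G e.
Proof.
rewrite pair_big/= /adj -big_mkcond/=.
rewrite (partition_big (fun p : T * T => [set p.1; p.2]%SET) (mem (edges G)))//=.
rewrite mulr_sumr; apply: eq_bigr => e eG.
rewrite (eq_bigr (fun=> weight G e)); last by move=> p /andP[_ /eqP ->].
rewrite sumr_const mulr_natl; congr (_ *+ _).
have /eqP/cards2P[x [y [xy exy]]] := card_edge eG.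
(* The fibre over the edge [e] consists of its two orientations. *)
rewrite -[RHS](_ : #|[set (x, y); (y, x)]%SET| = 2%N); last first.
  by rewrite cards2 xpair_eqE (negPf xy).
apply: eq_card => -[u v]; rewrite !inE/= !xpair_eqE.
apply/andP/orP => [[_ /eqP]|].
  rewrite exy => E.
  have : #|[set u; v]%SET| = 2%N by rewrite E cards2 xy.
  have : v \in [set x; y]%SET by rewrite -E !inE eqxx orbT.
  have : u \in [set x; y]%SET by rewrite -E !inE eqxx.
  rewrite !inE => /orP[] /eqP-> /orP[] /eqP->; rewrite cards2 !eqxx//= => _;
  by [left | right].
move=> H; have -> : [set u; v]%SET = e.
  by case: H => /andP[/eqP-> /eqP->]; rewrite exy// finset.setUC.
by rewrite eG eqxx.
Qed.

Lemma densityE (R : realType) (T : finType) (G : wgraph R T) :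
  density G = (\sum_u \sum_v adj G u v) / #|T|%:R ^+ 2.
Proof. by rewrite sum_adj /density; ring. Qed.

Lemma density_qform (R : realType) (T : finType) (G : wgraph R T) :
  density G = qform (adj G) (fun=> 1 / #|T|%:R).
Proof.
rewrite densityE mulr_suml; apply: eq_bigr => u _.
rewrite mulr_suml; apply: eq_bigr => v _.
by rewrite div1r -mulrA -expr2 exprVn.
Qed.

(** * Upper bound on the density of free graphs *)

(** An initial segment of [s] is the embedding, so the order of [s] decides which vertices take the
    special indices. *)
Lemma contains_seq (R : realType) (T : finType) (G : wgraph R T) (C : wclique R)
    (x0 : T) (s : seq T) :
  uniq s -> (csize C <= size s)%N ->
  (forall i j : 'I_(csize C), (i < j)%N ->
    cweight C [set i; j]%SET < adj G (nth x0 s i) (nth x0 s j)) ->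
  contains G C.
Proof.
move=> us ss H; exists (fun i => nth x0 s i); split.
  move=> i j /eqP; rewrite nth_uniq ?(leq_trans (ltn_ord _) ss)// => /eqP.
  exact: val_inj.
move=> i j ij; apply: adj_gtP; last exact: H.
have /andP[]// : 0 <= cweight C [set i; j]%SET <= 1.
by apply: cweight01; rewrite cards2 -val_eqE/= neq_ltn ij.
Qed.

Lemma density_upper (R : realType) (T : finType) (q r : nat) (a : R)
    (ha : 0 <= a <= 1) (G : wgraph R T) :
  (2 <= q)%N -> (q <= r)%N -> (0 < #|T|)%N ->
  is_free [set pair_clique q ha; Kclique r.+1 (zero01 R)] G ->
  density G <= Num.max (1 - 1 / (q%:R - 1)) (a * (1 - 1 / r%:R)).
Proof.
move=> q2 qr T0 freeG; rewrite density_qform.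
have a0 : 0 <= a by have /andP[] := ha.
apply: motzkin_straus; [exact: adjC | exact: adjxx | | | ]; last 2 first.
- by move=> _; rewrite div1r invr_ge0.
- by rewrite sumr_const -[LHS]mulr_natl div1r divff// pnatr_eq0 -lt0n.
move=> S clS S0.
have adj_gt0 u v : u \in S -> v \in S -> u != v -> 0 < adj G u v.
  by move=> uS vS uv; rewrite lt_neqAle adj_ge0 eq_sym clS.
have inv_mono (k l : nat) : (0 < k)%N -> (k <= l)%N ->
    1 - 1 / k%:R <= 1 - 1 / l%:R :> R.
  move=> k0 kl; rewrite lerD2l lerN2 !div1r lef_pV2 ?ler_nat// posrE ltr0n//.
  exact: leq_trans kl.
have S0' : (0 < #|S|)%N by rewrite card_gt0.
have /finset.set0Pn[x0 x0S] := S0.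
have Sr : (#|S| <= r)%N.
  (* Any [r.+1] vertices of [S] have pairwise positive weights and so form a copy of the forbidden
     clique. *)
  rewrite leqNgt; apply/negP => rS; apply: (freeG (Kclique r.+1 (zero01 R))).
    by right.
  have us := enum_uniq (mem S).
  apply: (@contains_seq _ _ _ _ x0 (enum S)); rewrite -?cardE// => i j ij/=.
  have lt (k : 'I_r.+1) : (k < size (enum S))%N.
    by rewrite -cardE; apply: leq_trans rS; exact: ltn_ord.
  have inS (k : 'I_r.+1) : nth x0 (enum S) k \in S by rewrite -mem_enum mem_nth.
  by apply: adj_gt0; rewrite ?inS// nth_uniq// neq_ltn ij.
have [qS|Sq] := leqP q #|S|; last first.
  exists 1 => //; split => [u v _ _|]; first exact: adj_le1.
  rewrite mul1r le_max; apply/orP; left.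
  have -> : q%:R - 1 = q.-1%:R :> R by rewrite -subn1 natrB// ltnW.
  by apply: inv_mono => //; rewrite -ltnS prednK// ltnW.
exists a => //; split; last first.
  by rewrite le_max; apply/orP; right; rewrite ler_wpM2l// inv_mono.
move=> u v uS vS; rewrite leNgt; apply/negP => auv.
have uv : u != v by apply: contraTneq auv => ->; rewrite adjxx -leNgt.
apply: (freeG (pair_clique q ha)); first by left.
(* The pair heavier than [a] comes first, at the indices 0 and 1 where the weight must exceed [a];
   elsewhere positivity is enough. *)
pose s := u :: v :: enum (S :\ u :\ v)%SET.
have us : uniq s.
  by rewrite /= enum_uniq !inE !mem_enum !inE !eqxx (negPf uv).
have sS : {subset s <= S}.
  by move=> y; rewrite !inE mem_enum !inE => /or3P[/eqP->|/eqP->|/and3P[]].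
have ss : size s = #|S|.
  rewrite /= -cardE (cardsD1 u S) uS (cardsD1 v (S :\ u)%SET) !inE vS eq_sym uv.
  by rewrite !add1n.
apply: (@contains_seq _ _ _ _ u s) => [||i j ij] //; first by rewrite ss.
have lt (k : 'I_q) : (k < size s)%N by rewrite ss (leq_trans (ltn_ord k)).
rewrite /= /pair_weight; case: ifPn => [/eqP E|_]; last first.
  by apply: adj_gt0; rewrite ?sS ?mem_nth// nth_uniq// neq_ltn ij.
have : j \in [set i : 'I_q | (i < 2)%N]%SET by rewrite -E !inE eqxx orbT.
rewrite inE => j2.
have j1 : j = 1%N :> nat by apply/eqP; rewrite eqn_leq -ltnS j2 (leq_trans _ ij).
have i0 : i = 0%N :> nat by apply/eqP; rewrite -leqn0 -ltnS -j1.
by rewrite i0 j1.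
Qed.

(** * Lower bound by balanced complete multipartite graphs *)

Section multipartite.
Variables (R : realType) (n k : nat) (c : R).
Hypothesis hc : 0 <= c <= 1.

(** The parts are the residue classes modulo [k], which makes them balanced without any divisibility
    assumption on [n]. *)
Let Eset : {set {set 'I_n}} :=
  [set e | [exists u : 'I_n, exists v : 'I_n,
    (u %% k != v %% k)%N && (e == [set u; v])]]%SET.

Let Eset2 e : e \in Eset -> #|e| = 2%N.
Proof.
rewrite inE => /existsP[u /existsP[v /andP[uv /eqP->]]].
by rewrite cards2; move: uv; have [->|] := eqVneq u v; rewrite ?eqxx.
Qed.

Definition multipartite : wgraph R 'I_n :=
  WGraph Eset2 (fun (e : {set 'I_n}) _ => hc).

Lemma multipartite_edge u v :
  ([set u; v]%SET \in edges multipartite) = (u %% k != v %% k)%N.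
Proof.
rewrite inE; apply/existsP/idP => [[x /existsP[y /andP[xy /eqP E]]]|uv]; last first.
  by exists u; apply/existsP; exists v; rewrite uv eqxx.
have xu : x \in [set u; v]%SET by rewrite E !inE eqxx.
have yu : y \in [set u; v]%SET by rewrite E !inE eqxx orbT.
move: xu yu xy; rewrite !inE => /orP[] /eqP-> /orP[] /eqP->; rewrite ?eqxx//.
by rewrite eq_sym.
Qed.

(** Pigeonhole: the vertices of a clique have distinct residues modulo [k]. *)
Lemma multipartite_free (C : wclique R) :
  (0 < k)%N -> (k < csize C)%N -> ~ contains multipartite C.
Proof.
move=> k0 kC [phi [_ H]].
suff /leq_card : injective (fun i => Ordinal (ltn_pmod (phi i) k0)).
  by rewrite !card_ord leqNgt kC.
move=> i j /(congr1 val)/= ij.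
apply/eqP; rewrite -val_eqE; apply: contraT; rewrite neq_ltn.
by move=> /orP[] /H[]; rewrite multipartite_edge ij eqxx.
Qed.

(** Containment is strict at every pair, so a single pair asking for more than [c] is an
    obstruction. *)
Lemma multipartite_free_heavy (C : wclique R) (i j : 'I_(csize C)) :
  (i < j)%N -> c <= cweight C [set i; j]%SET -> ~ contains multipartite C.
Proof. by move=> ij cC [phi [_ /(_ i j ij)[_]]]/=; rewrite ltNge cC. Qed.

(** Within a residue class [v] is determined by [v %/ k], which takes at most [n %/ k + 1] values;
    the summand [k] absorbs the rounding. *)
Lemma card_residue_le (u : nat) : (0 < k)%N ->
  (#|[pred v : 'I_n | v %% k == u %% k]| * k <= n + k)%N.
Proof.
move=> k0.
have f_lt (v : 'I_n) : (v %/ k < (n %/ k).+1)%N.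
  by rewrite ltnS leq_div2r// ltnW.
have : (#|[pred v : 'I_n | (v %% k == u %% k)%N]| <= #|'I_(n %/ k).+1|)%N.
  apply: (@leq_card_in _ _ (fun v : 'I_n => Ordinal (f_lt v))).
  move=> v w; rewrite !inE => /eqP vu /eqP wu /(congr1 val)/= vw.
  by apply: val_inj; rewrite /= (divn_eq v k) (divn_eq w k) vw vu wu.
rewrite card_ord => /(leq_mul (leqnn k)); rewrite mulnC => /leq_trans; apply.
by rewrite mulnS addnC leq_add2r mulnC leq_divM.
Qed.

Lemma multipartite_density : (0 < k)%N -> (0 < n)%N ->
  c * (1 - 1 / k%:R) - 1 / n%:R <= density multipartite.
Proof.
move=> k0 n0; have [c0 c1] := andP hc.
have kR : (0 : R) < k%:R by rewrite ltr0n.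
have nR : (0 : R) < n%:R by rewrite ltr0n.
rewrite densityE card_ord ler_pdivlMr ?exprn_gt0//.
(* A vertex misses only its own class, itself included, of size at most [n / k + 1]. *)
have row u : c * (n%:R - (n%:R + k%:R) / k%:R) <= \sum_v adj multipartite u v.
  have -> : \sum_v adj multipartite u v =
      c * (n%:R - #|[pred v : 'I_n | (v %% k == u %% k)%N]|%:R).
    rewrite -sum1_card natr_sum [X in _ - X]big_mkcond/=.
    have -> : n%:R = \sum_(v < n) 1 :> R by rewrite sumr_const card_ord.
    rewrite -sumrB mulr_sumr; apply: eq_bigr => v _.
    rewrite /adj multipartite_edge inE eq_sym/=.
    by case: eqP; rewrite /= ?subrr ?subr0 ?mulr0 ?mulr1.
  rewrite ler_wpM2l// lerD2l lerN2 ler_pdivlMr// -natrM -natrD ler_nat.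
  exact: card_residue_le.
apply: (@le_trans _ _ (\sum_(u < n) c * (n%:R - (n%:R + k%:R) / k%:R))).
  rewrite sumr_const card_ord -[leRHS]mulr_natl.
  (* Rounding costs [c * n] in total; as [c <= 1], this is at most the allowed loss [n], with slack
     [n * (1 - c)]. *)
  have -> : (c * (1 - 1 / k%:R) - 1 / n%:R) * n%:R ^+ 2 =
    n%:R * (c * (n%:R - (n%:R + k%:R) / k%:R)) - n%:R * (1 - c).
    by field; rewrite !gt_eqF.
  by rewrite gerBl mulr_ge0 ?subr_ge0// ltW.
by apply: ler_sum.
Qed.

End multipartite.

Theorem theorem3p5 (R : realType) (q r : nat) (a : R)
    (hq : (2 <= q)%N) (hqr : (q <= r)%N) (ha : 0 <= a <= 1) :
  let F : set (wclique R) :=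
    [set pair_clique q ha; Kclique r.+1 (zero01 R)] in
  cvg (beta F n @[n --> \oo]) /\
  turan_density F = Num.max (1 - 1 / (q%:R - 1)) (a * (1 - 1 / r%:R)).
Proof.
move=> F; set M := Num.max _ _.
have one01 : 0 <= (1 : R) <= 1 by rewrite ler01 lexx.
have q1 : (0 < q.-1)%N by rewrite -ltnS prednK// ltnW.
have q1q : (q.-1 < q)%N by rewrite prednK// ltnW.
have r0 : (0 < r)%N by rewrite (leq_trans _ hqr)// ltnW.
have freeq n : is_free F (multipartite n q.-1 one01).
  move=> C [] ->; apply: multipartite_free => //=.
  by rewrite ltnS (leq_trans _ hqr)// ltnW.
have freer n : is_free F (multipartite n r ha).
  move=> C [] ->; last exact: multipartite_free.
  (* With [r >= q] parts the pigeonhole fails for the first clique; the indices 0 and 1 ask for more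
     than [a], the constant weight. *)
  apply: (@multipartite_free_heavy _ _ _ _ _ (pair_clique q ha)
    (Ordinal (ltnW hq)) (Ordinal hq)) => //=.
  rewrite /pair_weight ifT//; apply/eqP/setP => -[i iq]; rewrite !inE -!val_eqE/=.
  by case: i iq => [|[|]].
have beta_le n : (0 < n)%N -> beta F n <= M.
  move=> n0; apply: ge_sup.
    (* Bounding the supremum requires a free graph to exist. *)
    exists (density (multipartite n r ha)), (multipartite n r ha) => //.
    exact: freer.
  by move=> _ [G fG <-]; apply: density_upper; rewrite ?card_ord.
have beta_ge n : (0 < n)%N -> M - 1 / n%:R <= beta F n.
  move=> n0; rewrite lerBlDr ge_max -!lerBlDr; apply/andP; split.
    apply: le_trans (beta_ub (freeq n)).
    have -> : q%:R - 1 = q.-1%:R :> R by rewrite -subn1 natrB// ltnW.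
    by have := multipartite_density one01 q1 n0; rewrite mul1r.
  by apply: le_trans (beta_ub (freer n)); exact: multipartite_density.
suff cvgM : beta F n @[n --> \oo] --> M.
  by split; [apply/cvg_ex; exists M | exact: (cvg_lim _ cvgM)].
apply: (@squeeze_cvgr _ _ _ _ (fun n : nat => M - 1 / n%:R) (fun=> M)).
- by exists 1%N => // n /= n0; rewrite beta_ge// beta_le.
- rewrite -[X in _ --> X]subr0; apply: cvgB; first exact: cvg_cst.
  (* Shifting the index by one turns [1 / n] into the harmonic sequence. *)
  rewrite -cvg_shiftS; under eq_fun do rewrite div1r; exact: cvg_harmonic.
- exact: cvg_cst.
Qed.
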